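(* Let $G\subset\mathbb{R}^d$ be a polyhedral set and let $f:G\to[0,+\infty)$ be a nonnegative concave function. Then $f$ possesses a unique continuous extension $F$ (that is, a unique continuous concave function $F$ on $G$ with $F(\boldsymbol{x})=f(\boldsymbol{x})$ for all $\boldsymbol{x}\in\operatorname{int}G$). On the boundary this extension is given by $$F(\boldsymbol{x})=\lim_{\boldsymbol{y}\in\operatorname{int}G,\ |\boldsymbol{x}-\boldsymbol{y}|\to 0} f(\boldsymbol{y}),\qquad \boldsymbol{x}\in\partial G .$$ Moreover, $F(\boldsymbol{x})\ge f(\boldsymbol{x})$ for every $\boldsymbol{x}\in G$.
   Context: A convex closed set $G\subset\mathbb{R}^d$ with nonempty interior is called polyhedral if it is the set of solutions of a system of finitely many linear (non-strict, possibly inhomogeneous) inequalities; it may be unbounded. For a nonnegative concave function $f$ on a convex closed set $G$ with nonempty interior, a continuous extension of $f$ is a continuous concave function $F$ on $G$ such that $F(\boldsymbol{x})=f(\boldsymbol{x})$ for all $\boldsymbol{x}\in\operatorname{int}G$ (the values of $F$ and $f$ on $\partial G$ may differ). $|\cdot|$ is the Euclidean norm. *)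

(* Defs.v *)
(* MathComp / MathComp-Analysis. *)
From HB Require Import structures.
From mathcomp Require Export all_boot all_order all_algebra.
From mathcomp Require Export interval_inference.
From mathcomp Require Export all_classical all_reals all_analysis.

Set Implicit Arguments.
Unset Strict Implicit.
Unset Printing Implicit Defensive.

Import Order.TTheory GRing.Theory Num.Theory.
Import numFieldNormedType.Exports.

Local Open Scope classical_set_scope.
Local Open Scope ring_scope.
Local Open Scope convex_scope.

Section definitions.
Context {R : realType} {d : nat}.
Implicit Types (G : set 'rV[R]_d) (f F : 'rV[R]_d -> R) (x y : 'rV[R]_d).

(* The library norm [`|x|] on ['rV[R]_d] is the max norm. Both norms induce
   the topology of ['rV[R]_d]: see [nbhs_enormP]. *)
Definition enorm x : R := Num.sqrt (\sum_(i < d) x 0 i ^+ 2).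

(* Convexity and closedness follow from the last clause; they are kept
   because they belong to the definition of a polyhedral set. The number m of
   inequalities may be 0, and some of the [a i] may vanish. *)
Definition polyhedral G : Prop :=
  [/\ convex_set G, closed G, G° !=set0 &
      exists (m : nat) (a : 'I_m -> 'rV[R]_d) (b : 'I_m -> R),
        G = [set x | forall i, \sum_(j < d) a i 0 j * x 0 j <= b i]].

(* Concave counterpart of the library's [convex_function]. Functions on G are
   total functions whose values outside G are irrelevant. *)
Definition concave_function G f : Prop :=
  forall t : {i01 R}, {in G &, forall x y : convex_lmodType 'rV[R]_d,
    (f x : R^o) <| t |> f y <= f (x <| t |> y)}.

Definition continuous_extension G f F : Prop :=
  [/\ concave_function G F, {within G, continuous F} & forall x, G° x -> F x = f x].

Definition frontier G : set 'rV[R]_d := closure G `\` G°.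

(* The filter "y \in int G, |x - y| -> 0", with |.| the Euclidean norm. *)
Definition interior_approach G x : set_system 'rV[R]_d :=
  filter_from [set e : R | 0 < e]
    (fun e => [set y | G° y /\ enorm (x - y) < e]).

Lemma nbhs_enormP x (A : set 'rV[R]_d) :
  nbhs x A <-> exists2 e : R, 0 < e & [set y | enorm (x - y) < e] `<=` A.
Proof.
have coord_le (z : 'rV[R]_d) i : `|z 0 i| <= enorm z.
  rewrite -sqrtr_sqr ler_sqrt ?sumr_ge0// => [|k _]; last exact: sqr_ge0.
  by rewrite (bigD1 i)//= lerDl sumr_ge0// => k _; exact: sqr_ge0.
have enorm_le (z : 'rV[R]_d) (c : R) : 0 <= c -> (forall i, `|z 0 i| <= c) ->
    enorm z <= Num.sqrt d%:R * c.
  move=> c0 zc; have -> : Num.sqrt d%:R * c = Num.sqrt (d%:R * c ^+ 2).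
    by rewrite sqrtrM ?ler0n// sqrtr_sqr ger0_norm.
  apply: ler_wsqrtr; rewrite mulr_natl -[in leRHS](card_ord d) -sumr_const.
  apply: ler_sum => i _; rewrite -real_normK ?num_real//.
  by rewrite lerXn2r// nnegrE.
split=> [/nbhs_ballP[e /= e0 eA]|[e e0 eA]].
  exists e => // y /= xye; apply: eA; split=> // i j.
  rewrite ord1; apply: le_lt_trans xye.
  by have := coord_le (x - y) j; rewrite !mxE.
have D0 : 0 < Num.sqrt d%:R + 1 :> R by rewrite ltr_wpDl// sqrtr_ge0.
pose c := e / (Num.sqrt d%:R + 1).
have c0 : 0 < c by rewrite divr_gt0.
apply/nbhs_ballP; exists c => //= y xy; apply: eA => /=.
apply: (@le_lt_trans _ _ (Num.sqrt d%:R * c)).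
  apply: enorm_le => [|i]; first exact: ltW.
  by have := xy.2 0 i; rewrite !mxE => /ltW.
by rewrite /c mulrA ltr_pdivrMr// mulrC ltr_pM2l// ltrDl.
Qed.

Lemma interior_approachE G x : interior_approach G x = within G° (nbhs x).
Proof.
apply/seteqP; split=> [A [e /= e0 eA]|A].
  rewrite /within/=; apply/nbhs_enormP; exists e => // y /= xye Gy.
  exact: eA.
by rewrite /within/= => /nbhs_enormP[e e0 eA]; exists e => // y [Gy /eA]; exact.
Qed.

End definitions.

(* Main.v *)
Require Import Defs.
From mathcomp Require Import lra ring.

Set Implicit Arguments.
Unset Strict Implicit.
Unset Printing Implicit Defensive.

Import Order.TTheory GRing.Theory Num.Theory.
Import numFieldNormedType.Exports.

Local Open Scope classical_set_scope.
Local Open Scope ring_scope.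

(** The basic inequality: if y = s z + (1 - s) x with x, z in G, then, f being
concave and f z nonnegative, f y >= (1 - s) f x ([concave_ge_scale]). Letting
s be small, f y is almost as large as f x whenever the point
z = x + (y - x) / s, obtained by blowing up the segment from x to y, still
lies in G.

In a polyhedral set this holds for every y in G close enough to x, for each
fixed s: the inequalities active at x are preserved by blowing up from x, and
the finitely many others hold near x ([polyhedral_near_homothety]). Hence a
nonnegative concave function on G is lower semicontinuous on all of G, boundary
included ([concave_near_gt]). Around an interior point x one can also blow up
the segment from y to x, which exchanges the two points in the inequality and
gives upper semicontinuity there ([concave_interior_near_lt]). So a nonnegative
concave function is continuous at x as soon as it is upper semicontinuous at x,
and in particular at the interior points.

It remains to repair upper semicontinuity on the boundary. Fix c in the
interior of G and put
  F x = inf over 0 < t < 1 of f (t c + (1 - t) x) / (1 - t).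
The segment from c to x lies in the interior of G except possibly for x, so for
each t the quotient is a concave and continuous function of x in G. An infimum
of such functions is concave and upper semicontinuous, hence F is continuous on
G by the previous paragraph. The basic inequality with z = c says that each
quotient is at least f x, so that F >= f; letting t tend to 0 gives F <= f at
the interior points.

Finally any continuous extension is, at each point of G, the limit of f along
the interior. As the interior is dense in G this limit is unique, which yields
both the uniqueness and the formula on the boundary. *)

(** * Blowing up a segment from one of its ends *)

(** The ratio is the inverse of s so that y has weight s on its image, and
1 - s on the center x. *)
Definition homothety {R : realType} {d : nat} (s : R) (x y : 'rV[R]_d) :
    'rV[R]_d :=
  x + s^-1 *: (y - x).

Section homothety.
Context {R : realType} {d : nat}.
Implicit Types (x y z : 'rV[R]_d) (s t : R).

Lemma homothetyK s x y : s != 0 -> s *: homothety s x y + (1 - s) *: x = y.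
Proof. by move=> s0; apply/rowP => i; rewrite !mxE; field. Qed.

Lemma homothety_conv s x z : s != 0 ->
  homothety s x (s *: z + (1 - s) *: x) = z.
Proof. by move=> s0; apply/rowP => i; rewrite !mxE; field. Qed.

Lemma homothety_center s x : homothety s x x = x.
Proof. by rewrite /homothety subrr scaler0 addr0. Qed.

Lemma homothety_continuous s x : continuous (homothety s x).
Proof.
by move=> y; exact: (cvgD (cvg_cst _) (cvgZl_tmp (cvgB cvg_id (cvg_cst _)))).
Qed.

Lemma homothety_continuous_center s y : continuous (homothety s ^~ y).
Proof.
by move=> x; exact: (cvgD cvg_id (cvgZl_tmp (cvgB (cvg_cst _) cvg_id))).
Qed.

End homothety.

(** * Convex sets and their interior *)

Section convexity.
Context {R : realType} {d : nat}.
Implicit Types (x y z c : 'rV[R]_d) (s t : R) (G : set 'rV[R]_d).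
Implicit Types f : 'rV[R]_d -> R.

Lemma convex_set_conv G : convex_set G ->
  forall t x y, 0 <= t -> t <= 1 -> G x -> G y -> G (t *: x + (1 - t) *: y).
Proof.
move=> cG t x y t0 t1 Gx Gy.
have := cG x y (Itv01 t0 t1); rewrite !inE; exact.
Qed.

Lemma concave_functionP G f : concave_function G f <->
  forall t x y, 0 <= t -> t <= 1 -> G x -> G y ->
    t * f x + (1 - t) * f y <= f (t *: x + (1 - t) *: y).
Proof.
split=> [cf t x y t0 t1 Gx Gy|cf t x y].
  have := cf (Itv01 t0 t1) x y; rewrite !inE; exact.
by rewrite !inE => Gx Gy; apply: cf.
Qed.

(** Blowing up from x with ratio 1 / t sends t c + (1 - t) x to c, hence a
neighbourhood of it into G; each point of that neighbourhood lies between x and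
its image, and so in G by convexity. *)
Lemma interior_conv G c x t : convex_set G -> G° c -> G x -> 0 < t -> t <= 1 ->
  G° (t *: c + (1 - t) *: x).
Proof.
move=> cG Gc Gx t0 t1.
have tN0 : t != 0 by rewrite gt_eqF.
have Gh : \forall y \near t *: c + (1 - t) *: x, G (homothety t x y).
  have := @homothety_continuous _ _ t x (t *: c + (1 - t) *: x).
  by rewrite /continuous_at homothety_conv// => /(_ _ Gc).
rewrite /interior; near=> y.
rewrite -(homothetyK x y tN0); apply: convex_set_conv => //; first exact: ltW.
by near: y.
Unshelve. all: by end_near. Qed.

Lemma cvg_segment c x :
  t *: c + (1 - t) *: x @[t --> (0 : R)^'+] --> x.
Proof.
apply: cvg_at_right_filter.
rewrite -[X in _ --> X](_ : 0 *: c + (1 - 0) *: x = x).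
  exact: (cvgD (cvgZr_tmp cvg_id) (cvgZr_tmp (cvgB (cvg_cst _) cvg_id))).
by rewrite scale0r subr0 scale1r add0r.
Qed.

Lemma closure_interior_convex G c x : convex_set G -> G° c -> G x ->
  closure G° x.
Proof.
move=> cG Gc Gx B /(cvg_segment c) xB; near (0 : R)^'+ => t.
exists (t *: c + (1 - t) *: x); split; last by near: t.
apply: interior_conv => //.
by near: t; exact: nbhs_right_le.
Unshelve. all: by end_near. Qed.

(** * Semicontinuity of nonnegative concave functions *)

Lemma concave_ge_scale G f x y s : concave_function G f ->
  (forall z, G z -> 0 <= f z) -> 0 < s -> s <= 1 ->
  G x -> G (homothety s x y) -> (1 - s) * f x <= f y.
Proof.
move=> /concave_functionP cf f0 s0 s1 Gx Gz.
rewrite -(homothetyK x y (lt0r_neq0 s0)).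
apply: le_trans (cf _ _ _ (ltW s0) s1 Gz Gx).
by rewrite lerDr mulr_ge0 ?f0// ltW.
Qed.

(** Used with a = f x for the lower bound, and with a = f x + e for the upper
bound. *)
Lemma exists_scale_gt (a e : R) : 0 <= a -> 0 < e ->
  exists s, [/\ 0 < s, s < 1 & a - e < (1 - s) * a].
Proof.
move=> a0 e0; have p : 0 < a + e + 1 by lra.
(* Any s in ]0, 1[ with s a < e would do. *)
exists (e / (a + e + 1)); split.
- by rewrite divr_gt0.
- by rewrite ltr_pdivrMr//; lra.
- rewrite mulrBl mul1r ltrD2l ltrN2 mulrAC ltr_pdivrMr//.
  by rewrite ltr_pM2l//; lra.
Qed.

Lemma cvg_linear_form (a : 'rV[R]_d) x :
  \sum_j a 0 j * y 0 j @[y --> x] --> \sum_j a 0 j * x 0 j.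
Proof.
apply: (cvg_big add_continuous) => j _.
by apply: cvgMl_tmp; exact: coord_continuous.
Qed.

(** This is the step that fails for a general convex set: near a boundary point
of a ball, the set can curve away from the blown-up segment however close y is
to x. *)
Lemma polyhedral_near_homothety G x s : polyhedral G -> 0 < s -> s <= 1 -> G x ->
  \forall y \near x, G y -> G (homothety s x y).
Proof.
move=> [_ _ _ [m [a [b ->]]]] s0 s1 Gx.
pose l i (y : 'rV[R]_d) := \sum_j a i 0 j * y 0 j.
have lh i y : l i (homothety s x y) = l i x + s^-1 * (l i y - l i x).
  rewrite /l mulrBr !mulr_sumr -sumrB -big_split/=; apply: eq_bigr => j _.
  by rewrite !mxE; ring.
have : \forall y \near x, forall i,
    l i y <= b i -> l i (homothety s x y) <= b i.
  apply: (@filter_forall _ _ _ _ (nbhs_filter x)) => i.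
  have := Gx i; rewrite /= -/(l i x) le_eqVlt => /predU1P[lx|lx].
    (* Active constraint: blowing up from x multiplies its slack by 1 / s. *)
    near=> y => ly; rewrite lh lx gerDl.
    by rewrite mulr_ge0_le0 ?invr_ge0 ?subr_le0// ltW.
  (* Inactive constraint: the blown-up point tends to x as y does. *)
  have lc : l i (homothety s x y) @[y --> x] --> l i x.
    have := continuous_comp (@homothety_continuous _ _ s x x)
      (@cvg_linear_form (a i) (homothety s x x)).
    by rewrite /prop_for /continuous_at/= homothety_center.
  have ly := cvgr_lt (FF := nbhs_filter x) _ lc _ lx.
  by near=> y => _; apply: ltW; near: y.
apply: (@filterS _ _ (nbhs_filter x)) => y yl Gy i; apply: yl; exact: Gy.
Unshelve. all: by end_near. Qed.

Lemma concave_near_gt G f x e : polyhedral G -> concave_function G f ->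
  (forall z, G z -> 0 <= f z) -> G x -> 0 < e ->
  \forall y \near x, G y -> f x - e < f y.
Proof.
move=> pG cf f0 Gx e0.
have [s [s0 s1 fs]] := exists_scale_gt (f0 _ Gx) e0.
have := polyhedral_near_homothety pG s0 (ltW s1) Gx; apply: filterS => y Gh Gy.
apply: lt_le_trans fs _; apply: concave_ge_scale => //; [exact: ltW|exact: Gh].
Qed.

(** Here the segment is blown up from the moving point y: its image
y + (x - y) / s tends to x, and so stays in G when x is interior. *)
Lemma concave_interior_near_lt G f x e : concave_function G f ->
  (forall z, G z -> 0 <= f z) -> G° x -> 0 < e ->
  \forall y \near x, f y < f x + e.
Proof.
move=> cf f0 Gx e0.
have fx0 := f0 _ (interior_subset Gx).
have [s [s0 s1 fs]] := exists_scale_gt (addr_ge0 fx0 (ltW e0)) e0.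
have Gh : \forall y \near x, G (homothety s y x).
  have := @homothety_continuous_center _ _ s x x.
  by rewrite /continuous_at homothety_center => /(_ _ Gx).
near=> y.
rewrite -(@ltr_pM2l _ (1 - s)) ?subr_gt0//; apply: le_lt_trans fs.
rewrite addrK; apply: (concave_ge_scale cf) => //.
- exact: ltW.
- by near: y.
- by near: y.
Unshelve. all: by end_near. Qed.

Lemma concave_cvg_within G f x : polyhedral G -> concave_function G f ->
  (forall z, G z -> 0 <= f z) -> G x ->
  (forall e, 0 < e -> \forall y \near x, G y -> f y < f x + e) ->
  f @ within G (nbhs x) --> f x.
Proof.
move=> pG cf f0 Gx usc.
apply/(@cvgrPdist_lt _ _ _ _ (within_filter _ (nbhs_filter x))) => e e0.
have lo := concave_near_gt pG cf f0 Gx e0.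
have up := usc _ e0.
rewrite near_withinE; near=> y => Gy.
by rewrite ltr_distlC; apply/andP; split; move: (Gy); near: y.
Unshelve. all: by end_near. Qed.

Lemma concave_cvg_interior G f x : polyhedral G -> concave_function G f ->
  (forall z, G z -> 0 <= f z) -> G° x -> f @ x --> f x.
Proof.
move=> pG cf f0 Gx; rewrite -(within_interior Gx).
apply: concave_cvg_within => // [|e e0]; first exact: interior_subset.
have up := concave_interior_near_lt cf f0 Gx e0.
by near=> y => _; near: y.
Unshelve. all: by end_near. Qed.

End convexity.

(** * The continuous extension *)

Definition radial_quotients {R : realType} {d : nat} (f : 'rV[R]_d -> R)
    (c x : 'rV[R]_d) : set R :=
  [set f (t *: c + (1 - t) *: x) / (1 - t) | t in `]0, 1[%classic].

(** The quotients decrease as t does, so this is the limit at x of f along the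
segment from c. The infimum makes sense without proving that this limit
exists, and the division by 1 - t makes every quotient an upper bound of
f x. *)
Definition radial_closure {R : realType} {d : nat} (f : 'rV[R]_d -> R)
    (c x : 'rV[R]_d) : R :=
  inf (radial_quotients f c x).

Section radial_closure.
Context {R : realType} {d : nat} (G : set 'rV[R]_d) (f : 'rV[R]_d -> R).
Context (c : 'rV[R]_d).
Hypotheses (pG : polyhedral G) (cf : concave_function G f)
  (f0 : forall z, G z -> 0 <= f z) (Gc : G° c).
Implicit Types (x y : 'rV[R]_d) (t e : R).

Let Gint x t : G x -> 0 < t -> t <= 1 -> G° (t *: c + (1 - t) *: x).
Proof. by case: pG => cG _ _ _; exact: interior_conv. Qed.

Lemma radial_quotients_neq0 x : radial_quotients f c x !=set0.
Proof.
exists (f (2^-1 *: c + (1 - 2^-1) *: x) / (1 - 2^-1)).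
by exists 2^-1 => //=; rewrite in_itv/=; lra.
Qed.

(** Blowing up the segment from x to t c + (1 - t) x by 1 / t leads to c. *)
Lemma radial_quotient_ge x t : G x -> 0 < t -> t < 1 ->
  f x <= f (t *: c + (1 - t) *: x) / (1 - t).
Proof.
move=> Gx t0 t1; rewrite ler_pdivlMr ?subr_gt0// mulrC.
apply: (concave_ge_scale cf) => //; first exact: ltW.
by rewrite homothety_conv ?gt_eqF//; exact: interior_subset.
Qed.

Lemma radial_closure_le x t : G x -> 0 < t -> t < 1 ->
  radial_closure f c x <= f (t *: c + (1 - t) *: x) / (1 - t).
Proof.
move=> Gx t0 t1; apply: ge_inf; last by exists t => //=; rewrite in_itv/= t0.
exists (f x) => z [s /=]; rewrite in_itv/= => /andP[s0 s1] <-.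
exact: radial_quotient_ge.
Qed.

Lemma le_radial_closure x a :
  (forall t, 0 < t -> t < 1 -> a <= f (t *: c + (1 - t) *: x) / (1 - t)) ->
  a <= radial_closure f c x.
Proof.
move=> ha; apply: lb_le_inf => [|z [s /=]]; first exact: radial_quotients_neq0.
by rewrite in_itv/= => /andP[s0 s1] <-; exact: ha.
Qed.

Lemma radial_closure_ge x : G x -> f x <= radial_closure f c x.
Proof.
by move=> Gx; apply: le_radial_closure => t t0 t1; exact: radial_quotient_ge.
Qed.

Lemma radial_closure_ge0 x : G x -> 0 <= radial_closure f c x.
Proof. by move=> Gx; apply: le_trans (radial_closure_ge Gx); exact: f0. Qed.

Lemma radial_closure_concave : concave_function G (radial_closure f c).
Proof.
apply/concave_functionP => p x y p0 p1 Gx Gy.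
apply: le_radial_closure => t t0 t1.
have -> : t *: c + (1 - t) *: (p *: x + (1 - p) *: y) =
    p *: (t *: c + (1 - t) *: x) + (1 - p) *: (t *: c + (1 - t) *: y).
  by apply/rowP => i; rewrite !mxE; ring.
have Gt z : G z -> G (t *: c + (1 - t) *: z).
  by move=> Gz; apply: interior_subset; apply: Gint => //; exact: ltW.
have /concave_functionP/(_ _ _ _ p0 p1 (Gt _ Gx) (Gt _ Gy)) := cf.
rewrite ler_pdivlMr ?subr_gt0//; apply: le_trans.
rewrite mulrDl -!mulrA lerD// ler_wpM2l ?subr_ge0//.
  by rewrite -ler_pdivlMr ?subr_gt0//; exact: radial_closure_le.
by rewrite -ler_pdivlMr ?subr_gt0//; exact: radial_closure_le.
Qed.

(** One almost minimizing t for x serves all nearby points, since the quotient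
for this t is continuous: the point t c + (1 - t) x is interior to G. *)
Lemma radial_closure_near_lt x e : G x -> 0 < e ->
  \forall y \near x, G y -> radial_closure f c y < radial_closure f c x + e.
Proof.
move=> Gx e0.
have [t [t0 t1 fte]] : exists t, [/\ 0 < t, t < 1 &
    f (t *: c + (1 - t) *: x) / (1 - t) < radial_closure f c x + e].
  have : radial_closure f c x < radial_closure f c x + e by rewrite ltrDl.
  move=> /(inf_lt (radial_quotients_neq0 x))[z [t /=]].
  by rewrite in_itv/= => /andP[t0 t1] <- h; exists t.
have cq : f (t *: c + (1 - t) *: y) / (1 - t) @[y --> x] -->
    f (t *: c + (1 - t) *: x) / (1 - t).
  apply: (cvgMr_tmp (FF := nbhs_filter x)).
  have ct : {for x, continuous (fun y => t *: c + (1 - t) *: y)}.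
    exact: (cvgD (cvg_cst _) (cvgZl_tmp cvg_id)).
  have cfx := concave_cvg_interior pG cf f0 (Gint Gx t0 (ltW t1)).
  exact: (continuous_comp ct cfx).
have up := cvgr_lt (FF := nbhs_filter x) _ cq _ fte.
near=> y => Gy; apply: le_lt_trans (radial_closure_le Gy t0 t1) _.
by near: y.
Unshelve. all: by end_near. Qed.

Lemma radial_closure_cvg x : G x ->
  radial_closure f c @ within G (nbhs x) --> radial_closure f c x.
Proof.
move=> Gx; apply: concave_cvg_within => //.
- exact: radial_closure_concave.
- exact: radial_closure_ge0.
- by move=> e; exact: radial_closure_near_lt.
Qed.

Lemma radial_closure_interior x : G° x -> radial_closure f c x = f x.
Proof.
move=> Gx; apply/eqP; rewrite eq_le radial_closure_ge ?andbT; last first.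
  exact: interior_subset.
have cinv : (1 - t)^-1 @[t --> (0 : R)^'+] --> (1 - 0 : R)^-1.
  apply: cvg_at_right_filter; apply: cvgV; first by rewrite subr0 oner_neq0.
  exact: (cvgB (cvg_cst _) cvg_id).
have fs := cvg_comp _ _ (@cvg_segment _ _ c x)
  (concave_cvg_interior pG cf f0 Gx).
have q0 : f (t *: c + (1 - t) *: x) / (1 - t) @[t --> (0 : R)^'+] --> f x.
  by have /(_ _) := cvgM fs cinv; rewrite subr0 invr1 mulr1; apply.
apply: (cvgr_to_ge q0); near=> t; apply: radial_closure_le.
- exact: interior_subset.
- by near: t; exact: nbhs_right_gt.
- by near: t; exact: nbhs_right_lt.
Unshelve. all: by end_near. Qed.

End radial_closure.

Theorem proposition1 (R : realType) (d : nat)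
    (G : set 'rV[R]_d) (f : 'rV[R]_d -> R)
    (polyG : polyhedral G)
    (f_ge0 : forall x, G x -> 0 <= f x)
    (f_concave : concave_function G f) :
  exists F : 'rV[R]_d -> R,
    [/\ continuous_extension G f F,
        (forall F' : 'rV[R]_d -> R,
           continuous_extension G f F' -> forall x, G x -> F' x = F x),
        (forall x, frontier G x -> f @ interior_approach G x --> F x) &
        (forall x, G x -> f x <= F x)].
Proof.
have [cG clG [c Gc] _] := polyG.
(* Any continuous extension is the limit of f along the interior; both the
   uniqueness and the formula on the boundary follow. *)
have ext_cvg F x : {within G, continuous F} -> (forall y, G° y -> F y = f y) ->
    G x -> f @ within G° (nbhs x) --> F x.
  move=> /subspace_continuousP Fc Ff Gx A /(Fc x Gx) Fx.
  apply: (@filterS _ _ (nbhs_filter x)) Fx => y /= FA Gy.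
  by rewrite /= -(Ff y Gy); apply: FA; exact: interior_subset.
have FE : continuous_extension G f (radial_closure f c).
  split.
  - exact: radial_closure_concave.
  - by apply/subspace_continuousP => x Gx; exact: radial_closure_cvg.
  - by move=> x; exact: radial_closure_interior.
exists (radial_closure f c); split => //.
- move=> F' [_ F'c F'f] y Gy; have [_ Fc Ff] := FE.
  have yG := within_nbhs_proper (closure_interior_convex cG Gc Gy).
  apply: (norm_cvg_unique (FF := fmap_proper_filter f yG)).
    exact: ext_cvg F'c F'f Gy.
  exact: ext_cvg Fc Ff Gy.
- move=> y [yG _]; rewrite interior_approachE; have [_ Fc Ff] := FE.
  by apply: ext_cvg => //; rewrite (closure_id G).1.
- by move=> y; exact: radial_closure_ge.
Qed.
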